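(* Let $D$ be an eulerian digraph in which all but exactly two vertices have degree congruent to $2$ mod $4$ (so the remaining two vertices $x,y$ have degree congruent to $0$ mod $4$), and let $T$ be a directed euler circuit of $D$ that interlaces $x$ and $y$. Then $D$ has a bi-eulerian directed embedding (necessarily orientable) with one of its faces bounded by $T$.
   Context: Digraphs are finite and may have loops and multiple arcs; the degree of a vertex is its total degree. A digraph is eulerian if it has a directed circuit using every arc and every vertex (a directed euler circuit). A circuit interlaces two vertices $x$ and $y$ if its cyclic vertex sequence can be written as $(\dots x \dots y \dots x \dots y \dots)$. Embeddings are cellular in closed surfaces; a directed embedding is one in which every face is bounded by a directed closed walk; a bi-eulerian directed embedding is one with exactly two faces, each bounded by a directed euler circuit. *)

(* Defs.v *)
From mathcomp Require Import all_boot fingroup perm.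

Set Implicit Arguments.
Unset Strict Implicit.
Unset Printing Implicit Defensive.

Record digraph := Digraph {
  vertex : finType;
  arcs : finType;
  arc_tail : arcs -> vertex;
  arc_head : arcs -> vertex }.

(* The dart (a, false) is the end of the arc a at its tail, and (a, true) is
   the end of a at its head. *)
Notation dart D := (arcs D * bool)%type.

(* The flag (d, s) stands for the traversal of an arc that leaves along the
   dart d, together with the side of the arc on which the traced face lies: on
   the left, say, with respect to the local orientation at d if s = false, and
   to its reverse if s = true. *)
Notation flag D := (dart D * bool)%type.

Section Digraphs.
Variable D : digraph.
Implicit Types (v x y : vertex D) (a : arcs D) (w : seq (arcs D)).

(* A loop at v lies in both sets, hence contributes 2. *)
Definition degree v : nat := #|[set a | arc_tail a == v]| + #|[set a | arc_head a == v]|.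

(* Closed walks are written as sequences of arcs, from an arbitrary starting
   point; their cyclic vertex sequence is [map tail w]. *)
Definition directed_closed_walk w : bool :=
  path.cycle [rel a b : arcs D | arc_head a == arc_tail b] w.

Definition directed_euler_circuit w : bool :=
  [&& directed_closed_walk w, uniq w, [forall a, a \in w]
    & [forall v, v \in map (@arc_tail D) w]].

Definition eulerian : Prop := exists w, directed_euler_circuit w.

Definition interlaces w x y : Prop :=
  exists n, subseq [:: x; y; x; y] (rot n (map (@arc_tail D) w)).

Definition dart_vertex (d : dart D) : vertex D :=
  if d.2 then arc_head d.1 else arc_tail d.1.

Definition opposite (d : dart D) : dart D := (d.1, ~~ d.2).

(* Cellular embeddings of a connected digraph with at least one arc in closed
   surfaces, orientable or not, given by signed rotation systems: after a local
   orientation of the surface is chosen at every vertex, [rotation] lists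
   cyclically the darts around each vertex, and an arc is [twisted] when the
   local orientations at its two ends disagree along it. *)
Record embedding := Embedding {
  rotation : {perm dart D};
  twisted : arcs D -> bool;
  rotationP : forall d e : dart D,
    (e \in porbit rotation d) = (dart_vertex d == dart_vertex e) }.

Section Faces.
Variable M : embedding.

Definition face_step (f : flag D) : flag D :=
  let s := f.2 (+) twisted M f.1.1 in
  let d := opposite f.1 in
  ((if s then (rotation M)^-1%g d else rotation M d), s).

(* The same side of the same arc, traversed in the opposite direction. *)
Definition face_reverse (f : flag D) : flag D :=
  (opposite f.1, ~~ (f.2 (+) twisted M f.1.1)).

(* The two directions of traversal of a boundary are two different orbits of
   [face_step]; together they make up one face. *)
Definition face_of (f : flag D) : {set flag D} :=
  [set g | (g \in fingraph.orbit face_step f)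
           || (g \in fingraph.orbit face_step (face_reverse f))].

Definition faces : {set {set flag D}} := [set face_of f | f : flag D].

(* The starting point and the direction of traversal of the boundary of F are
   free, but all the arcs of w are traversed from tail to head. *)
Definition bounded_by (F : {set flag D}) w : Prop :=
  exists2 f, f \in F &
    [seq g.1 | g <- fingraph.orbit face_step f] = [seq (a, false) | a <- w].

Definition directed_embedding : Prop :=
  forall F, F \in faces -> exists2 w, directed_closed_walk w & bounded_by F w.

Definition bi_eulerian : Prop :=
  [/\ directed_embedding, #|faces| = 2
    & forall F, F \in faces -> exists2 w, directed_euler_circuit w & bounded_by F w].

(* Reversing the local orientations at the vertices v with c v = true leaves no
   arc twisted. *)
Definition orientable : Prop :=
  exists c : vertex D -> bool, forall a, twisted M a = c (arc_tail a) (+) c (arc_head a).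

End Faces.
End Digraphs.

(* Main.v *)
Require Import Defs.
From mathcomp Require Import all_boot fingroup perm.

(* An orientable directed embedding with two faces amounts to a pair of one-cycle
   permutations of the arcs: t, the successor in T, and s, the successor in the
   other circuit. Going twice around a corner of a vertex acts on the out-arcs as
   c = s^-1 t (read from left to right), so the rotation at v is a single cycle
   exactly when the out-arcs of v form one orbit of c. Hence one looks for c whose
   orbits are the sets of out-arcs of the vertices and for which s^-1 = c t^-1 has
   a single orbit. If T visits out-arcs x1, y1, x2, y2 of x, y, x, y in this
   order, the transpositions (x1 x2) and (y1 y2) together keep a single orbit; the
   number of out-arcs still to be absorbed is then even at every vertex, and they
   are absorbed two at a time by 3-cycles, one of the two orientations of which
   preserves the single orbit. *)

Set Implicit Arguments.
Unset Strict Implicit.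
Unset Printing Implicit Defensive.

(** * Orbit counts of permutations multiplied by transpositions *)

Section PermutationOrbits.
Variable A : finType.
Implicit Types (a b p q : A) (s u c : {perm A}).

Lemma porbit_closed s (S : {pred A}) a b :
  {in S, forall z, s z \in S} -> a \in S -> b \in porbit s a -> b \in S.
Proof.
move=> sS aS /porbitP[i ->]; rewrite permX.
by elim: i => //= i; apply: sS.
Qed.

Lemma porbit_step s a b : b \in porbit s a -> s b \in porbit s a.
Proof. by rewrite porbit_sym -(porbit_perm s 1) expg1 porbit_sym. Qed.

Lemma single_porbit s a b : #|porbits s| = 1 -> b \in porbit s a.
Proof.
move=> s1; have /eqP/cards1P[P sP] := s1.
have Pz z : porbit s z = P.
  by apply/set1P; rewrite -sP imset_f.
by rewrite -eq_porbit_mem !Pz.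
Qed.

Lemma porbits_single s a : (forall b, b \in porbit s a) -> #|porbits s| = 1.
Proof.
move=> sa; apply/eqP/cards1P; exists (porbit s a); apply/setP=> P.
rewrite inE; apply/imsetP/eqP=> [[b _ ->]|->]; last by exists a.
by apply/eqP; rewrite eq_porbit_mem sa.
Qed.

Lemma porbits_split u p q :
  p != q -> #|porbits u| = 1 -> #|porbits (tperm p q * u)%g| = 2.
Proof.
move=> pq u1; have := porbits_mul_tperm u p q.
by rewrite /= single_porbit // u1 pq addn0.
Qed.

Lemma porbits_join u p q :
  p \notin porbit u q -> #|porbits u| = 2 -> #|porbits (tperm p q * u)%g| = 1.
Proof.
move=> pq u2; have := porbits_mul_tperm u p q; rewrite /= pq u2.
have -> : p != q by apply: contraNneq pq => ->; apply: porbit_id.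
by rewrite (addnC 2) addnC => /addnI.
Qed.

(* Cutting the cycle u at p and q leaves two orbits, and b misses one of them. *)
Lemma mul_3cycle u p q b : p != q -> #|porbits u| = 1 ->
  #|porbits (tperm b q * (tperm p q * u))%g| = 1
  \/ #|porbits (tperm b p * (tperm q p * u))%g| = 1.
Proof.
move=> pq u1; have u2 := porbits_split pq u1.
have [bq|] := boolP (b \in porbit (tperm p q * u)%g q); last first.
  by move=> bq; left; apply: porbits_join.
right; rewrite (tpermC q p); apply: porbits_join => //.
(* Otherwise [p] and [q] would share an orbit of [tperm p q * u], and a second factor [tperm p q]
   would split it, whereas it gives back [u] with its single orbit. *)
apply/negP=> bp.
have qp : q \in porbit (tperm p q * u)%g p.
  by move: bq bp; rewrite -!eq_porbit_mem => /eqP <- /eqP ->.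
have := porbits_mul_tperm (tperm p q * u)%g p q.
by rewrite /= mulgA tperm2 mul1g u1 u2 pq porbit_sym qp.
Qed.

(** The two transpositions form a 3-cycle, which inserts the fixed points [p] and [q] of [c] right
    after [b] in the cycle of [b]. *)
Lemma perm_3cycle c p q b (c' := (tperm b q * (tperm p q * c))%g) :
    c p = p -> c q = q -> b != p -> b != q -> p != q ->
  [/\ c' b = p, c' p = q, c' q = c b
    & forall z, z != b -> z != p -> z != q -> c' z = c z].
Proof.
move=> cp cq bp bq pq; split=> [||| z zb zp zq]; rewrite /c' !permM.
- by rewrite tpermL tpermR.
- by rewrite (tpermD bp) 1?eq_sym // tpermL.
- by rewrite tpermR tpermD // eq_sym.
by rewrite !tpermD // eq_sym.
Qed.

Lemma porbit_3cycle c p q b a (c' := (tperm b q * (tperm p q * c))%g) :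
    c p = p -> c q = q -> b != p -> b != q -> p != q ->
  a \in porbit c b \/ a = p \/ a = q -> a \in porbit c' b.
Proof.
move=> cp cq bp bq pq.
have [c'b c'p c'q c'E] := perm_3cycle cp cq bp bq pq; rewrite -/c' in c'b c'p c'q c'E.
have pb : p \in porbit c' b by rewrite -c'b porbit_step ?porbit_id.
have qb : q \in porbit c' b by rewrite -c'p porbit_step.
case=> [|[] -> //]; apply: porbit_closed (porbit_id _ _) => z zb.
have [->|z'b] := eqVneq z b; first by rewrite -c'q porbit_step.
have [->|z'p] := eqVneq z p; first by rewrite cp.
have [->|z'q] := eqVneq z q; first by rewrite cq.
by rewrite -c'E // porbit_step.
Qed.

End PermutationOrbits.

(** * Permutations with prescribed orbits *)

Section BlockCycles.
Variables (A : finType) (V : eqType) (f : A -> V).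

Let block (R : {set A}) v := [set a in R | f a == v].

(* R consists of the elements not yet absorbed: outside R, the orbits of c already
   are the blocks. *)
Lemma extend_block_cycles (u c : {perm A}) (R : {set A}) :
    (forall a, f (c a) = f a) -> {in R, forall a, c a = a} ->
    (forall a, exists2 b, b \notin R & f b = f a) ->
    (forall a b, a \notin R -> b \notin R -> f a = f b -> b \in porbit c a) ->
    (forall v, ~~ odd #|block R v|) ->
    #|porbits (c * u)%g| = 1 ->
  exists2 c' : {perm A}, forall a b, (b \in porbit c' a) = (f a == f b)
    & #|porbits (c' * u)%g| = 1.
Proof.
have [n] := ubnP #|R|; elim: n => // n IHn in c R *.
rewrite ltnS => Rn fc cR R' cR' Rodd cu1.
have [R0|[p pR]] := set_0Vmem R.
  exists c => // a b; apply/idP/eqP; last by apply: cR'; rewrite R0 inE.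
  move=> ab; apply/eqP; rewrite eq_sym.
  apply: (@porbit_closed _ c [pred z | f z == f a]) ab; rewrite ?inE // => z.
  by rewrite !inE fc.
have pB : p \in block R (f p) by rewrite inE pR /=.
have [q] : exists q, q \in block R (f p) :\ p.
  apply/set0Pn; apply: contraNneq (Rodd (f p)) => B0.
  by rewrite (cardsD1 p) B0 pB cards0.
rewrite !inE => /and3P[qp qR /eqP fq].
have [b bR fb] := R' p.
have bp : b != p by apply: contraNneq bR => ->.
have bq : b != q by apply: contraNneq bR => ->.
have cp := cR _ pR; have cq := cR _ qR.
(* [mul_3cycle] decides in which order [p] and [q] are inserted after [b]; [p1], [q1] stand for
   either order. *)
have step p1 q1 : p1 != q1 -> [set p1; q1] = [set p; q] ->
    c p1 = p1 -> c q1 = q1 -> b != p1 -> b != q1 -> f p1 = f p -> f q1 = f p ->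
    #|porbits (tperm b q1 * (tperm p1 q1 * (c * u)))%g| = 1 ->
  exists2 c' : {perm A}, forall a b, (b \in porbit c' a) = (f a == f b)
    & #|porbits (c' * u)%g| = 1.
  move=> pq1 Epq cp1 cq1 bp1 bq1 fp1 fq1 c'u1.
  have [c'b c'p c'q c'E] := perm_3cycle cp1 cq1 bp1 bq1 pq1.
  have c'orb := porbit_3cycle cp1 cq1 bp1 bq1 pq1.
  set c' := (_ * _)%g in c'b c'p c'q c'E c'orb.
  have inpq z : (z == p1) || (z == q1) = (z == p) || (z == q).
    by have := congr1 (fun S : {set A} => z \in S) Epq; rewrite !inE.
  have inR1 z : z \in R :\: [set p; q] = ~~ ((z == p1) || (z == q1)) && (z \in R).
    by rewrite !inE inpq.
  have c'all z : z \notin R :\: [set p; q] -> f z = f p -> z \in porbit c' b.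
    rewrite inR1 negb_and negbK => zR fz; apply: c'orb.
    case/orP: zR => [/orP[]/eqP->|zR]; [by right; left|by right; right|left].
    by apply: cR'; rewrite // fb fz.
  apply: (IHn c' (R :\: [set p; q])).
  - apply: leq_trans Rn; apply: proper_card; apply/properP.
    by rewrite subsetDl; split=> //; exists p; rewrite // !inE eqxx.
  - move=> z; have [->|zb] := eqVneq z b; first by rewrite c'b fp1 fb.
    have [->|zp] := eqVneq z p1; first by rewrite c'p fp1 fq1.
    have [->|zq] := eqVneq z q1; first by rewrite c'q fq1 fc fb.
    by rewrite c'E.
  - move=> z; rewrite inR1 negb_or -andbA => /and3P[zp zq zR].
    by rewrite c'E ?cR //; apply: contraNneq bR => <-.
  - move=> z; have [d dR fd] := R' z; exists d => //.
    by rewrite inE negb_and dR orbT.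
  - move=> z t zR tR fzt; have [fz|fz] := eqVneq (f z) (f p).
      have := c'all z zR fz; have : t \in porbit c' b by apply: c'all; rewrite -?fzt.
      by rewrite -!eq_porbit_mem => /eqP-> /eqP->.
    have out y : f y != f p -> y \notin R :\: [set p; q] -> y \notin R.
      move=> fy; rewrite inR1 negb_and negbK => /orP[/orP[]/eqP yE|] //;
      by case/eqP: fy; rewrite yE.
    have tz : t \in porbit c z by apply: (cR' _ _ (out _ _ zR) (out _ _ tR) fzt); rewrite -?fzt.
    (* Outside the block of [p], the permutations [c'] and [c] agree, so the whole [c]-orbit of [z]
       is also traced by [c']. *)
    have: t \in [pred y | (y \in porbit c' z) && (f y != f p)].
      apply: porbit_closed tz => [y|]; rewrite !inE ?fc ?porbit_id // => /andP[yz fy].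
      have ne d : f d = f p -> y != d by move=> fd; apply: contraNneq fy => ->; rewrite fd.
      by rewrite fy andbT -c'E ?porbit_step ?ne.
    by case/andP.
  - move=> v; have [<-|fv] := eqVneq (f p) v.
      have := Rodd (f p); rewrite (cardsD1 p) pB (cardsD1 q) !inE qp qR fq eqxx /= negbK.
      by congr (~~ odd _); apply: eq_card => z; rewrite !inE negb_or -!andbA andbCA.
    have -> : block (R :\: [set p; q]) v = block R v; last exact: Rodd.
    apply/setP=> z; rewrite !inE; have [fz|] := eqVneq (f z) v; rewrite ?andbF // !andbT.
    have ne d : f d = f p -> z != d.
      by move=> fd; apply: contraNneq fv => zd; rewrite -fz zd fd.
    by rewrite !(negPf (ne _ _)).
  by rewrite /c' -!mulgA.
have [] := mul_3cycle b (_ : p != q) cu1; first by rewrite eq_sym.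
  by apply: step; rewrite // eq_sym.
by apply: step; rewrite // setUC.
Qed.

(** The absorption starts from [(x1 x2)(y1 y2)], with two elements already absorbed in the blocks of
    [X] and [Y] and one in every other block; [fodd] makes the remainders even. *)
Lemma block_cycles (u : {perm A}) (X Y : V) (x1 x2 y1 y2 : A) :
    #|porbits u| = 1 -> X != Y -> x1 != x2 -> y1 != y2 ->
    f x1 = X -> f x2 = X -> f y1 = Y -> f y2 = Y ->
    y1 \notin porbit (tperm x1 x2 * u)%g y2 ->
    (forall a, odd #|[set b | f b == f a]| = (f a != X) && (f a != Y)) ->
  exists2 c : {perm A}, forall a b, (b \in porbit c a) = (f a == f b)
    & #|porbits (c * u)%g| = 1.
Proof.
move=> u1 XY x12 y12 fx1 fx2 fy1 fy2 y12u fodd.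
(* One representative per block; the default of [odflt] is reached only at values that [f] does not
   take. *)
pose base v := if v == X then x1 else if v == Y then y1
               else odflt x1 [pick b | f b == v].
have YX : Y == X = false by rewrite eq_sym; apply: negPf.
have baseX : base X = x1 by rewrite /base eqxx.
have baseY : base Y = y1 by rewrite /base YX eqxx.
have fbase a : f (base (f a)) = f a.
  rewrite /base; case: (eqVneq (f a) X) => [->//|_]; case: (eqVneq (f a) Y) => [->//|_].
  by case: pickP => [b /eqP //|/(_ a)]; rewrite eqxx.
pose R := [set a | [&& a != base (f a), a != x2 & a != y2]].
have xy a b : f a = X -> f b = Y -> a != b.
  by move=> fa fb; apply: contraNneq XY => ab; rewrite -fa -fb ab.
pose c := (tperm y1 y2 * tperm x1 x2)%g.
have cE a : a != x1 -> a != x2 -> a != y1 -> a != y2 -> c a = a.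
  by move=> *; rewrite permM !tpermD // eq_sym.
have cx1 : c x1 = x2 by rewrite permM (@tpermD _ y1 y2) ?tpermL // eq_sym xy.
have cy1 : c y1 = y2 by rewrite permM tpermL tpermD // xy.
have Rbase a : a \notin R -> a \in porbit c (base (f a)).
  rewrite inE !negb_and !negbK => /or3P[]/eqP E.
  - by rewrite {1}E porbit_id.
  - by rewrite E fx2 baseX -cx1 porbit_step ?porbit_id.
  - by rewrite E fy2 baseY -cy1 porbit_step ?porbit_id.
apply: (@extend_block_cycles u c R).
- have ftperm d e a : f d = f e -> f (tperm d e a) = f a.
    by move=> de; case: tpermP => [->|->|].
  by move=> a; rewrite permM !ftperm ?fx1 ?fy1.
- move=> a; rewrite inE => /and3P[ab ax ay]; apply: cE => //.
    by apply: contraNneq ab => ->; rewrite fx1 baseX.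
  by apply: contraNneq ab => ->; rewrite fy1 baseY.
- by move=> a; exists (base (f a)); rewrite ?fbase // inE fbase eqxx.
- move=> a b /Rbase; rewrite -eq_porbit_mem => /eqP pa /Rbase + ab.
  by rewrite -ab -eq_porbit_mem -pa eq_porbit_mem.
- move=> v; rewrite /block; have [B0|[a]] := set_0Vmem [set a in R | f a == v]; first by rewrite B0 cards0.
  rewrite !inE => /andP[_ /eqP fa]; have := fodd a; rewrite fa.
  have bv : f (base v) == v by rewrite -fa fbase.
  rewrite (cardsD1 (base v)) inE bv /=.
  have [vX|vX] := eqVneq v X.
    rewrite (cardsD1 x2) !inE fx2 vX baseX (eq_sym x2) x12 eqxx /= negbK => oddB.
    rewrite (_ : [set _ in _ | _] = [set b | f b == X] :\ x1 :\ x2) ?oddB //.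
    apply/setP=> z; rewrite !inE; case: (eqVneq (f z) X) => [fz|]; rewrite ?andbF // !andbT.
    by rewrite fz baseX (xy z y2) // andbT andbC.
  have [vY|vY] := eqVneq v Y.
    rewrite (cardsD1 y2) !inE fy2 vY baseY (eq_sym y2) y12 eqxx /= negbK => oddB.
    rewrite (_ : [set _ in _ | _] = [set b | f b == Y] :\ y1 :\ y2) ?oddB //.
    apply/setP=> z; rewrite !inE; case: (eqVneq (f z) Y) => [fz|]; rewrite ?andbF // !andbT.
    by rewrite fz baseY (eq_sym z x2) (xy x2 z) // andbC.
  rewrite add0n => oddB.
  rewrite (_ : [set _ in _ | _] = [set b | f b == v] :\ base v) ?oddB //.
  apply/setP=> z; rewrite !inE; case: (eqVneq (f z) v) => [fz|]; rewrite ?andbF // !andbT fz.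
  have ne d : f d != v -> z != d by apply: contraNneq => <-; rewrite fz.
  by rewrite (ne x2) ?(ne y2) ?andbT // ?fx2 ?fy2 eq_sym.
(* [tperm x1 x2] splits the orbit of [u]; [y12u] puts [y1] and [y2] in different pieces, so
   [tperm y1 y2] joins them again. *)
by rewrite -mulgA porbits_join // porbits_split.
Qed.
End BlockCycles.

(** * Orbits as lists, and the successor permutation of a circuit *)

Lemma mem_orbit_perm (A : finType) (s : {perm A}) a b :
  (b \in fingraph.orbit s a) = (b \in porbit s a).
Proof.
rewrite -fconnect_orbit; apply/idP/porbitP => [/iter_findex <-|[i ->]].
  by exists (findex s a b); rewrite permX.
by rewrite permX fconnect_iter.
Qed.

Lemma orbit_map (A B : finType) (f : A -> A) (g : B -> B) (h : A -> B) a :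
  injective f -> injective h -> (forall z, g (h z) = h (f z)) ->
  fingraph.orbit g (h a) = map h (fingraph.orbit f a).
Proof.
move=> f_inj h_inj ghf.
have hc : fcycle g (map h (fingraph.orbit f a)).
  rewrite cycle_map; apply: sub_cycle (cycle_orbit f_inj a) => z _ /eqP <-.
  by rewrite /= ghf.
rewrite (orbitE hc) ?map_inj_uniq ?orbit_uniq ?map_f ?in_orbit // index_map //.
by rewrite /fingraph.orbit -orderSpred /= eqxx rot0.
Qed.

Section Interlacing.
Variables (A : finType) (T : seq A).
Hypothesis T_uniq : uniq T.

Definition next_perm : {perm A} := perm (can_inj (prev_next T_uniq)).

Lemma orbit_next_perm (a : A) : a \in T ->
  fingraph.orbit next_perm a = rot (index a T) T.
Proof.
move=> aT; apply: orbitE => //.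
by apply: cycle_from_next => // z _ /=; rewrite permE.
Qed.

Lemma porbits_next_perm (a : A) : (forall b, b \in T) -> #|porbits next_perm| = 1.
Proof.
move=> allT; apply: (@porbits_single _ _ a) => b.
by rewrite -mem_orbit_perm orbit_next_perm // mem_rot.
Qed.

(* One of the two orbits left by the transposition lies among the elements from
   x1 up to, but excluding, x2, which include y1 and not y2. *)
Lemma interlaced_split n (x1 y1 x2 y2 : A) :
  (forall b, b \in T) -> subseq [:: x1; y1; x2; y2] (rot n T) ->
  y1 \notin porbit (tperm x1 x2 * next_perm^-1)%g y2.
Proof.
move=> allT; set W := rot n T => sub.
have W_uniq : uniq W by rewrite rot_uniq.
have allW b : b \in W by rewrite mem_rot.
pose lt := [rel a b | index a W < index b W].
have lt_tr : transitive lt by move=> ? ? ?; apply: ltn_trans.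
have W_lt : sorted lt W.
  by apply/(sortedP x1) => i iW; rewrite /= !index_uniq // ltnW.
have := subseq_sorted lt_tr sub W_lt => /= /and4P[x1y1 y1x2 x2y2 _].
pose S := [pred z | index x1 W <= index z W < index x2 W].
rewrite porbit_sym; apply/negP=> y12.
have : y2 \in S.
  apply: porbit_closed y12 => [z|]; last by rewrite inE (ltnW x1y1).
  rewrite !inE permM => /andP[x1z zx2].
  set w := tperm x1 x2 z.
  (* The transposition exchanges the end [x1] of the interval for [x2]; one step back then returns
     into [S], without wrapping around since the index of [w] is positive. *)
  have /andP[] : index x1 W < index w W <= index x2 W.
    rewrite /w; case: tpermP => [_|zE|zx1 _].
    - by rewrite leqnn (ltn_trans x1y1).
    - by rewrite zE ltnn in zx2.
    rewrite (ltnW zx2) andbT ltn_neqAle x1z andbT.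
    by apply: contra_not_neq zx1 => E; rewrite -(nth_index x1 (allW z)) -E nth_index.
  case iw : (index w W) => [//|k] x1k kx2.
  have kW : k.+1 < size W by rewrite -iw index_mem.
  suff -> : next_perm^-1%g w = nth w W k by rewrite index_uniq ?kx2 ?andbT // ltnW.
  apply: (canLR (permK _)); rewrite permE -(next_rot n) // -/W next_nth allW.
  case: (W) W_uniq iw kW => // b W' Wu iw kW; rewrite index_uniq //; last exact: ltnW.
  by rewrite -[RHS]/(nth b (b :: W') k.+1) -iw nth_index // -index_mem iw.
by rewrite inE (ltnNge _ (index x2 W)) (ltnW x2y2) andbF.
Qed.

End Interlacing.

(** * The embedding with two faces *)

Section TwoFaces.
Variable D : digraph.
Implicit Types (a b : arcs D) (t u c : {perm arcs D}).

Lemma orbit_euler u a :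
  (forall b, arc_tail (u b) = arc_head b) -> #|porbits u| = 1 ->
  (forall v : vertex D, exists b : arcs D, arc_tail b = v) ->
  directed_euler_circuit (fingraph.orbit u a).
Proof.
move=> uth u1 tail_surj.
have mem_u b : b \in fingraph.orbit u a by rewrite mem_orbit_perm single_porbit.
apply/and4P; split; rewrite ?orbit_uniq //; last 2 first.
- exact/forallP.
- by apply/forallP=> v; have [b <-] := tail_surj v; rewrite map_f.
by apply: sub_cycle (cycle_orbit perm_inj a) => b d /eqP <- /=; rewrite uth.
Qed.

Section Construction.
Variables t c : {perm arcs D}.
Hypothesis t_tail : forall a, arc_tail (t a) = arc_head a.
Hypothesis c_tail : forall a b, (b \in porbit c a) = (arc_tail a == arc_tail b).
(** The predecessor map of the second circuit. *)
Let u := (c * t^-1)%g.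
Hypotheses (t1 : #|porbits t| = 1) (u1 : #|porbits u| = 1).

(* Around a vertex, each corner from an in-arc a to the out-arc t a is followed
   by a corner from the latter to an in-arc that precedes it in the circuit of
   the inverse of u. *)
Definition corner_map (d : dart D) : dart D :=
  if d.2 then (t d.1, false) else (u d.1, true).

Lemma corner_map_inj : injective corner_map.
Proof. by move=> [a []] [b []] //= [/perm_inj ->]. Qed.

Definition corner_rotation := perm corner_map_inj.

Lemma c_preserves_tail a : arc_tail (c a) = arc_tail a.
Proof. by apply/eqP; rewrite eq_sym -c_tail porbit_step ?porbit_id. Qed.

Lemma u_head a : arc_head (u a) = arc_tail a.
Proof. by rewrite permM -t_tail permKV c_preserves_tail. Qed.

(** Two steps of the rotation act on out-darts as [c], and every dart shares its orbit with the
    out-dart [out] of its corner, so the orbits are those of [c]. *)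
Lemma corner_rotationP (d e : dart D) :
  (e \in porbit corner_rotation d) = (dart_vertex d == dart_vertex e).
Proof.
have rE f : corner_rotation f = corner_map f by rewrite permE.
have rot_vertex f : dart_vertex (corner_rotation f) = dart_vertex f.
  by rewrite rE; case: f => a [] /=; rewrite /dart_vertex /= ?t_tail ?u_head.
apply/idP/eqP => [|de].
  move=> ed; apply/eqP; rewrite eq_sym.
  apply: (@porbit_closed _ corner_rotation [pred f | dart_vertex f == dart_vertex d]) ed.
    by move=> f; rewrite !inE rot_vertex.
  by rewrite inE.
pose out (f : dart D) := if f.2 then t f.1 else f.1.
have out_tail f : arc_tail (out f) = dart_vertex f.
  by case: f => a []; rewrite /out /dart_vertex //= t_tail.
have porbit_out f : porbit corner_rotation (out f, false) = porbit corner_rotation f.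
  case: f => a []; rewrite /out //=; apply/eqP.
  have ta : (t a, false) = corner_rotation (a, true) by rewrite rE.
  by rewrite eq_porbit_mem ta porbit_step ?porbit_id.
rewrite -porbit_out -eq_porbit_mem -(porbit_out e) eq_porbit_mem.
have : out e \in porbit c (out d) by rewrite c_tail !out_tail de.
apply: (@porbit_closed _ c [pred b | (b, false) \in porbit corner_rotation (out d, false)]).
  move=> b; rewrite !inE => bd.
  rewrite (_ : (c b, false) = corner_rotation (corner_rotation (b, false))) ?porbit_step //.
  by rewrite !rE /corner_map /= permM permKV.
by rewrite inE porbit_id.
Qed.

Definition two_face_embedding := Embedding (fun _ => false) corner_rotationP.

Let M := two_face_embedding.

(** As no arc is twisted, a face keeps its direction and side: tail to head it follows [t] on one
    side and [u^-1] on the other, and in the reverse direction their inverses. *)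
Definition face_perm (f : flag D) : {perm arcs D} :=
  if f.1.2 then (if f.2 then t^-1 else u)%g else (if f.2 then u^-1 else t)%g.

Lemma two_face_step (f : flag D) :
  face_step M f = (face_perm f f.1.1, f.1.2, f.2).
Proof.
have rE d : corner_rotation d = corner_map d by rewrite permE.
case: f => [[a []] []]; rewrite /face_step /face_perm /= ?rE //=;
  congr (_, _); apply: (canLR (permK _)); by rewrite rE /corner_map /= permKV.
Qed.

Lemma two_face_orbit (f : flag D) :
  fingraph.orbit (face_step M) f
  = [seq (b, f.1.2, f.2) | b <- fingraph.orbit (face_perm f) f.1.1].
Proof.
case: f => [[a o] s] /=; apply: (orbit_map (h := fun b => (b, o, s))).
- exact: perm_inj.
- by move=> ? ? [].
by move=> b; rewrite two_face_step.
Qed.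

Lemma face_perm_single f : #|porbits (face_perm f)| = 1.
Proof. by case: f => [[a []] []]; rewrite /face_perm /= ?porbitsV. Qed.

Lemma mem_two_face_orbit (f g : flag D) :
  (g \in fingraph.orbit (face_step M) f) = (g.1.2 == f.1.2) && (g.2 == f.2).
Proof.
rewrite two_face_orbit; apply/mapP/andP => [[b _ ->] //|[/eqP go /eqP gs]].
exists g.1.1; last by rewrite -go -gs; case: g {go gs} => [[]].
by rewrite mem_orbit_perm single_porbit ?face_perm_single.
Qed.

(** [face_reverse] flips both direction and side, so their sum identifies the face: [false] for the
    circuit of [t], [true] for that of [u^-1]. *)
Definition side_face (k : bool) : {set flag D} := [set g | g.1.2 (+) g.2 == k].

Lemma face_of_side (f : flag D) : face_of M f = side_face (f.1.2 (+) f.2).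
Proof.
apply/setP=> [[[b o] s]]; rewrite !inE !mem_two_face_orbit /=.
by case: f => [[a []] []]; case: o; case: s.
Qed.

Variable a0 : arcs D.

Lemma two_faces : faces M = [set side_face false; side_face true].
Proof.
apply/setP=> F; apply/imsetP/set2P => [[f _ ->]|].
  by rewrite face_of_side; case: (_ (+) _); [right|left].
by case=> ->; [exists (a0, false, false)|exists (a0, false, true)];
  rewrite // face_of_side.
Qed.

Lemma card_two_faces : #|faces M| = 2.
Proof.
rewrite two_faces cards2; case: eqP => // /setP/(_ (a0, false, false)).
by rewrite !inE.
Qed.

Lemma two_face_bounded k :
  bounded_by M (side_face k)
    (fingraph.orbit (face_perm (a0, false, k)) a0).
Proof.
exists (a0, false, k); first by rewrite inE.
by rewrite two_face_orbit -map_comp.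
Qed.

Lemma two_face_bi_eulerian :
  (forall v : vertex D, exists a, arc_tail a = v) -> bi_eulerian M.
Proof.
move=> tail_surj.
have euler k : directed_euler_circuit (fingraph.orbit (face_perm (a0, false, k)) a0).
  apply: orbit_euler; rewrite ?face_perm_single // => b.
  by case: k; rewrite /face_perm /= ?t_tail // -u_head permKV.
have bounded F : F \in faces M ->
    exists2 w, directed_euler_circuit w & bounded_by M F w.
  rewrite two_faces => F2; have [k ->] : exists k, F = side_face k.
    by case/set2P: F2 => ->; eexists.
  by eexists; [exact: euler | exact: two_face_bounded].
split=> //; last exact: card_two_faces.
by move=> F /bounded[w /and4P[wc _ _ _] wF]; exists w.
Qed.

End Construction.
End TwoFaces.

(** * Orientability *)

Lemma uniq_map_inj_in (A B : eqType) (h : A -> B) (s : seq A) :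
  uniq (map h s) -> {in s &, injective h}.
Proof.
move=> us a b sa sb hab.
have : index a s == index b s.
  rewrite -(nth_uniq (h a) _ _ us) ?size_map ?index_mem //.
  by rewrite !(nth_map a) ?index_mem // !nth_index // hab.
by move=> /eqP E; rewrite -(nth_index a sa) E nth_index.
Qed.

Section Orientability.
Variables (D : digraph) (M : embedding D).
Implicit Types (f g h : flag D) (F : {set flag D}).

Lemma oppositeK : involutive (@opposite D).
Proof. by move=> [a o]; rewrite /opposite negbK. Qed.

Lemma face_reverseK : involutive (@face_reverse D M).
Proof.
move=> [[a o] s]; rewrite /face_reverse /opposite /= negbK.
by case: (twisted M a); case: s.
Qed.

(** Reversal conjugates [face_step] to its inverse, which makes [face_step] injective and lets
    reversal carry orbits to orbits. *)
Lemma face_step_reverse f : face_step M (face_reverse M (face_step M f)) = face_reverse M f.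
Proof.
have stepE d s : face_step M (d, s) =
    ((if s (+) twisted M d.1 then (rotation M)^-1 else rotation M)%g (opposite d),
     s (+) twisted M d.1).
  by rewrite /face_step /=; case: ifP.
rewrite [X in face_reverse _ X]/face_step /face_reverse stepE /= oppositeK.
rewrite addNb addbK; congr (_, _).
by case: (_ (+) _); rewrite /= ?permK ?permKV.
Qed.

Lemma face_step_inj : injective (face_step M).
Proof.
move=> f g E; apply: (can_inj face_reverseK).
by rewrite -(face_step_reverse f) E face_step_reverse.
Qed.

Local Notation conn := (fconnect (face_step M)).

Let conn_sym : connect_sym (frel (face_step M)) := fconnect_sym face_step_inj.

Lemma face_reverse_orbit f g : conn f g -> conn (face_reverse M f) (face_reverse M g).
Proof.
move=> /iter_findex <-; elim: (findex _ f g) => //= n.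
move/connect_trans; apply; rewrite conn_sym -(face_step_reverse (iter _ _ _)).
exact: fconnect1.
Qed.

(** Lying in the same orbit up to reversal is an equivalence relation, so distinct faces are
    disjoint. *)
Lemma face_of_eq f g : g \in face_of M f -> face_of M g = face_of M f.
Proof.
have revE h k : conn (face_reverse M h) k = conn h (face_reverse M k).
  by apply/idP/idP => /face_reverse_orbit; rewrite face_reverseK.
rewrite inE -!fconnect_orbit => gf; apply/setP=> h; rewrite !inE -!fconnect_orbit.
case/orP: gf => fg.
  by rewrite !revE !(same_connect conn_sym fg).
have := fg; rewrite revE => gf.
by rewrite (same_connect conn_sym gf) (same_connect conn_sym fg) orbC.
Qed.

Lemma directed_face_orbit f w :
    directed_euler_circuit w ->
    [seq h.1 | h <- fingraph.orbit (face_step M) f] = [seq (a, false) | a <- w] ->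
  [/\ forall h, h \in fingraph.orbit (face_step M) f -> h.1.2 = false,
      forall a, exists s, (a, false, s) \in fingraph.orbit (face_step M) f
    & forall a s s', (a, false, s) \in fingraph.orbit (face_step M) f ->
        (a, false, s') \in fingraph.orbit (face_step M) f -> s = s'].
Proof.
move=> /and4P[_ w_uniq /forallP w_all _] E; set O := fingraph.orbit _ f in E *.
split=> [h hO|a|a s s' sO s'O].
- by have : h.1 \in map fst O by [rewrite map_f]; rewrite E => /mapP[a _ ->].
- have : (a, false) \in map fst O by rewrite E map_f.
  by case/mapP=> [[d s]] sO /= aE; exists s; rewrite aE.
have uO : uniq (map fst O) by rewrite E map_inj_uniq // => ? ? [].
by case: (uniq_map_inj_in uO sO s'O erefl).
Qed.

(* The two boundary circuits cover all the flags on the tail-to-head sides of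
   the arcs, so in-darts and out-darts alternate around each vertex, and the
   local orientation may be read off the side on which the first face lies. *)
Lemma bi_eulerian_orientable : bi_eulerian M -> orientable M.
Proof.
case=> _ /eqP/cards2P[F1 [F2 [F12 FE]]] euler.
have [w1 w1_euler [f1 f1F w1E]] : exists2 w, directed_euler_circuit w & bounded_by M F1 w.
  by apply: euler; rewrite FE set21.
have [w2 w2_euler [f2 f2F w2E]] : exists2 w, directed_euler_circuit w & bounded_by M F2 w.
  by apply: euler; rewrite FE set22.
have [fwd1 all1 uniq1] := directed_face_orbit w1_euler w1E.
have [fwd2 all2 _] := directed_face_orbit w2_euler w2E.
set O1 := fingraph.orbit _ f1 in fwd1 all1 uniq1.
set O2 := fingraph.orbit _ f2 in fwd2 all2.
have face_ofF F f : F \in faces M -> f \in F -> face_of M f = F.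
  by case/imsetP=> g _ ->; apply: face_of_eq.
have disj h : h \in O1 -> h \in O2 -> False.
  rewrite -!fconnect_orbit => h1 h2; case/eqP: F12.
  have <- : face_of M f1 = F1 by apply: face_ofF; rewrite // FE set21.
  have <- : face_of M f2 = F2 by apply: face_ofF; rewrite // FE set22.
  by transitivity (face_of M h); [symmetry|]; apply: face_of_eq;
    rewrite inE -fconnect_orbit ?h1 ?h2.
(* [O1] and [O2] are disjoint and each contains a side of [a], so every tail-to-head flag lies in
   one of them. *)
have step_fwd a s : (face_step M (a, false, s)).1.2 = false.
  have [s1 s1O] := all1 a; have [s2 s2O] := all2 a.
  have [<-|ss1] := eqVneq s1 s; first exact/fwd1/mem_orbit.
  have [<-|ss2] := eqVneq s2 s; first exact/fwd2/mem_orbit.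
  have s12 : s1 = s2 by case: (s1) (s2) (s) ss1 ss2 => [] [] [].
  by case: (disj (a, false, s1)) => //; rewrite s12.
pose sigma a := (a, false, true) \in O1.
have sigmaE a s : ((a, false, s) \in O1) = (s == sigma a).
  rewrite /sigma; case: s; first by case: (_ \in _).
  have [aT|aF] := boolP ((a, false, true) \in O1).
    by apply/idP => /(uniq1 _ _ _ aT).
  by have [[] sO] := all1 a; [rewrite sO in aF|rewrite sO].
(* The side of the first face as seen by the local orientation at the vertex of [d]; at the head,
   the twist of the arc corrects it. *)
pose phi (d : dart D) := if d.2 then sigma d.1 (+) twisted M d.1 else sigma d.1.
pose turn (s : bool) := if s then (rotation M)^-1%g else rotation M.
have turnE a s : (turn s (a, true)).2 = false /\ phi (turn s (a, true)) = phi (a, true).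
  have stepE : face_step M (a, false, s (+) twisted M a) = (turn s (a, true), s).
    by rewrite /face_step /= addbK /turn; case: s.
  have d2 : (turn s (a, true)).2 = false.
    by have := step_fwd a (s (+) twisted M a); rewrite stepE.
  (* [O1] is closed under [face_step] in both directions, which relates [sigma] on consecutive
     arcs. *)
  split=> //; have := sigmaE a (s (+) twisted M a).
  rewrite /O1 -fconnect_orbit (same_fconnect1_r face_step_inj) stepE fconnect_orbit.
  case: (turn _ _) d2 => b o /= ->; rewrite -/O1 sigmaE /phi /=.
  by case: s {stepE} (sigma b) (sigma a) (twisted M a) => [] [] [] [].
(* [turnE] starts from in-darts only. By finiteness the injection [g] is onto, so every out-dart
   precedes an in-dart in the rotation, and [phi] is invariant there too. *)
pose g a := (turn true (a, true)).1.
have gE a : turn true (a, true) = (g a, false).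
  by have [+ _] := turnE a true; rewrite /g; case: (turn _ _) => b o /= ->.
have g_inj : injective g.
  move=> a b gab; have : turn true (a, true) = turn true (b, true) by rewrite !gE gab.
  by move/perm_inj => [].
have phi_rot d : phi (rotation M d) = phi d.
  case: d => a []; first by have [] := turnE a false.
  have [g' _ g'K] := injF_bij g_inj.
  rewrite -(g'K a) -gE; have [_ ->] := turnE (g' a) true.
  by rewrite /turn permKV.
have phi_vertex d e : dart_vertex d = dart_vertex e -> phi d = phi e.
  move/eqP; rewrite -(rotationP M) => ed; apply/eqP; rewrite eq_sym.
  apply: (@porbit_closed _ (rotation M) [pred z | phi z == phi d]) ed.
    by move=> z; rewrite !inE phi_rot.
  by rewrite inE.
(* The value [false] occurs by default only at vertices without darts. *)
pose c v := if [pick d | dart_vertex d == v] is Some d then phi d else false.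
have cE d : c (dart_vertex d) = phi d.
  by rewrite /c; case: pickP => [e /eqP/phi_vertex //|/(_ d)]; rewrite eqxx.
exists c => a; rewrite (cE (a, false)) (cE (a, true)) /phi /=.
by rewrite addKb.
Qed.

End Orientability.

(** * Parity of degrees and assembly of the theorem *)

Lemma degree_out (D : digraph) (t : {perm arcs D}) (v : vertex D) :
  (forall a, arc_tail (t a) = arc_head a) ->
  degree v = #|[set a : arcs D | arc_tail a == v]|.*2.
Proof.
move=> t_tail; rewrite -addnn; congr (_ + _).
(* [t] maps the arcs entering [v] bijectively to the arcs leaving it. *)
rewrite -[RHS](card_imset _ (@perm_inj _ t^-1%g)); apply: eq_card => a.
rewrite inE; apply/eqP/imsetP => [<-|[b]].
  by exists (t a); rewrite ?permK // inE t_tail.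
by rewrite inE => /eqP <- ->; rewrite -t_tail permKV.
Qed.

Lemma eqn_double_mod4 k : (k.*2 = 2 %[mod 4]) <-> odd k.
Proof.
rewrite -{1}(odd_double_half k) doubleD -!muln2 -mulnA addnC modnMDl.
by case: (odd k).
Qed.

Theorem theorem4p8 (D : digraph) (x y : vertex D) (T : seq (arcs D))
  (D_eulerian : eulerian D)
  (xDy : x != y)
  (degD : forall v : vertex D,
     (degree v = 2 %[mod 4]) <-> (v <> x /\ v <> y))
  (T_euler : directed_euler_circuit T)
  (T_xy : interlaces T x y) :
  (exists M : embedding D,
     bi_eulerian M /\ exists2 F, F \in faces M & bounded_by M F T)
  /\ (forall M : embedding D, bi_eulerian M -> orientable M).
Proof.
split; last exact: bi_eulerian_orientable.
have [T_walk T_uniq /forallP T_all /forallP T_vertex] := and4P T_euler.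
(* The mask that selects [x], [y], [x], [y] among the tails selects four arcs of [T] when applied to
   the arcs themselves. *)
have [n] := T_xy; rewrite -map_rot => /subseqP[m _].
rewrite -map_mask; case E: (mask m (rot n T)) => [|x1 [|y1 [|x2 [|y2 [|]]]]] //= [].
move=> xE yE x2E y2E.
have sub : subseq [:: x1; y1; x2; y2] (rot n T) by rewrite -E mask_subseq.
have : uniq [:: x1; y1; x2; y2] by rewrite (subseq_uniq sub) ?rot_uniq.
rewrite /= !inE !negb_or => /and4P[/and3P[_ x12 _] /andP[_ y12] _ _].
set t := next_perm T_uniq.
have t1 : #|porbits t| = 1 by apply: porbits_next_perm.
have t_tail a : arc_tail (t a) = arc_head a.
  by have /eqP := next_cycle T_walk (T_all a); rewrite permE.
have [c c_tail ct1] : exists2 c : {perm arcs D},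
    forall a b, (b \in porbit c a) = (arc_tail a == arc_tail b)
    & #|porbits (c * t^-1)%g| = 1.
  apply: (@block_cycles _ _ _ _ x y x1 x2 y1 y2) => //; first by rewrite porbitsV.
    exact: interlaced_split sub.
  (* The degree is twice the out-degree, so it is 2 mod 4 exactly when the out-degree is odd. *)
  move=> a; have := degD (arc_tail a).
  rewrite (degree_out _ t_tail) => -[odd_xy xy_odd].
  apply/idP/andP => [/eqn_double_mod4/odd_xy[ax ay]|[/eqP ax /eqP ay]]; last first.
    exact/eqn_double_mod4/xy_odd.
  by split; apply/eqP.
(* With the first arc of [T] as [a0], the orbit list of [t] is [T] itself rather than a rotation of
   it. *)
have [a0 a0T] : exists a0, index a0 T = 0.
  by case: (T) (T_all x1) => // a0 T' _; exists a0; rewrite /= eqxx.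
exists (two_face_embedding t_tail c_tail); split.
  apply: two_face_bi_eulerian => // v.
  by have /mapP[a _ ->] := T_vertex v; exists a.
exists (side_face D false); first by rewrite two_faces // !inE eqxx.
have := two_face_bounded t_tail c_tail a0 false.
by rewrite /face_perm /= orbit_next_perm // a0T rot0.
Qed.
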